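(* Let $\gamma=(\gamma^{x_1},\gamma^{y_1},\dots,\gamma^{x_n},\gamma^{y_n},\gamma^t):[0,1]\to\mathbb{R}^{2n+1}$ be a curve and let $\alpha\in\big(\frac12,1\big]$. Then $\gamma\in C^{0,\alpha}([0,1];\mathbb{H}^n)$ if and only if $\pi\circ\gamma\in C^{0,\alpha}([0,1];\mathbb{R}^{2n})$ and $$\gamma^t(b)-\gamma^t(a)=-2\sum_{j=1}^n\int_a^b\gamma^{x_j}\,d\gamma^{y_j}-\gamma^{y_j}\,d\gamma^{x_j}\qquad\text{for all }0\le a<b\le1.$$ Moreover, if these equivalent conditions hold, then $$d_K(\gamma(b),\gamma(a))\le C\,|b-a|^\alpha\,[\pi\circ\gamma]_\alpha\qquad\text{for all }0\le a<b\le1,$$ where the constant $C$ depends on $n$ and $\alpha$ only.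
   Context: Heisenberg group: $\mathbb{H}^n$ is $\mathbb{R}^{2n+1}$ with coordinates $(z,t)=(x_1,y_1,\dots,x_n,y_n,t)$, regarded as a metric space with the Korányi metric $$d_K\big((z,t),(z',t')\big)=\Big(|z-z'|^4+\Big|t-t'+2\sum_{j=1}^n(x_j'y_j-x_jy_j')\Big|^2\Big)^{1/4}.$$ $\pi:\mathbb{R}^{2n+1}\to\mathbb{R}^{2n}$, $\pi(z,t)=z$. $C^{0,\alpha}(X;Y)$ is the set of $\alpha$-Hölder continuous maps between metric spaces and $[f]_\alpha=\sup_{x\ne y}d_Y(f(x),f(y))/d_X(x,y)^\alpha$. Generalized integral: for $f,g\in C^{0,\alpha}([a,b])$ with $\alpha>\frac12$, $$\int_a^b f\,dg:=\lim_{\varepsilon\to0}\int_a^b f^\varepsilon(x)(g^\varepsilon)'(x)\,dx,$$ where $f^\varepsilon,g^\varepsilon$ are Lipschitz functions with $f^\varepsilon\to f$ and $g^\varepsilon\to g$ in the $C^{0,\alpha'}([a,b])$ norm for some $\alpha'\in(\frac12,\alpha]$. The limit exists and does not depend on the approximation. *)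

(* Defs.v *)
From mathcomp Require Export all_boot all_order all_algebra.
From mathcomp Require Export all_classical all_reals all_analysis.
Export Order.TTheory GRing.Theory Num.Theory.
Export numFieldNormedType.Exports.

Set Implicit Arguments.
Unset Strict Implicit.
Unset Printing Implicit Defensive.

Local Open Scope classical_set_scope.
Local Open Scope ring_scope.

Section Hoelder.
Context {R : realType} {X Y : Type} (dX : X -> X -> R) (dY : Y -> Y -> R).

(* f is in C^{0,alpha}(A; Y), for f defined on X and A a subset of X. *)
Definition hoelder_on (A : set X) (alpha : R) (f : X -> Y) : Prop :=
  exists L : R, forall x y, A x -> A y ->
    dY (f x) (f y) <= L * dX x y `^ alpha.

(* As a supremum of nonnegative quantities this is only meant for sets A with
   at least two points: on other sets it is -oo. *)
Definition hoelder_seminorm (A : set X) (alpha : R) (f : X -> Y) : \bar R :=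
  ereal_sup [set r : \bar R | exists x y, [/\ A x, A y, x <> y &
    r = (dY (f x) (f y) / dX x y `^ alpha)%:E]].

End Hoelder.

Section GeneralizedIntegral.
Context {R : realType}.
Implicit Types (a b alpha beta : R) (f g : R -> R).

Definition dist_real (s t : R) : R := `|s - t|.

Definition hoelder_norm a b alpha f : \bar R :=
  (ereal_sup [set `|f x|%R%:E | x in `[a, b]]
   + hoelder_seminorm dist_real dist_real `[a, b] alpha f)%E.

Definition lipschitz_approx a b beta f (F : R -> R -> R) : Prop :=
  (forall e, 0 < e -> exists k : R, k.-lipschitz_(`[a, b]) (F e)) /\
  hoelder_norm a b beta (F e \- f) @[e --> 0^'+] --> 0%E.

(* The derivative of a Lipschitz function exists only almost everywhere on
   [a, b]; derive1 takes a fixed default value at the points where the limit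
   of the difference quotients does not exist. *)
Definition is_gen_integral alpha a b f g (I : R) : Prop :=
  exists (beta : R) (F G : R -> R -> R),
    [/\ 2^-1 < beta <= alpha,
        lipschitz_approx a b beta f F,
        lipschitz_approx a b beta g G &
        \int[lebesgue_measure]_(x in `[a, b]) (F e x * derive1 (G e) x)
          @[e --> 0^'+] --> I].

(* For f and g alpha-Hoelder on [a, b], alpha > 1/2 and a < b, the limit I
   exists and does not depend on beta, F and G, so get selects that unique
   value. *)
Definition gen_integral alpha a b f g : R := get (is_gen_integral alpha a b f g).

End GeneralizedIntegral.

Section Heisenberg.
Context {R : realType}.

Definition dist_eucl (m : nat) (u v : 'rV[R]_m) : R :=
  Num.sqrt (\sum_(i < m) (u ord0 i - v ord0 i) ^+ 2).

Context {n : nat}.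

(* A point (x_1, y_1, ..., x_n, y_n, t) of R^(2n+1) is a row vector; with
   indices counted from 0, x_j is the entry 2j, y_j the entry 2j+1 and t the
   entry 2n. *)
Implicit Types p q : 'rV[R]_(n.*2.+1).

Definition xcoord (j : 'I_n) p : R := p ord0 (inord j.*2).
Definition ycoord (j : 'I_n) p : R := p ord0 (inord j.*2.+1).
Definition tcoord p : R := p ord0 ord_max.
Definition hproj p : 'rV[R]_(n.*2) := \row_i p ord0 (lift ord_max i).

Definition dist_koranyi p q : R :=
  (dist_eucl (hproj p) (hproj q) ^+ 4 +
   `|tcoord p - tcoord q +
     2 * \sum_(j < n) (xcoord j q * ycoord j p - xcoord j p * ycoord j q)| ^+ 2)
  `^ 4^-1.

End Heisenberg.

(* Main.v *)
From HB Require Import structures.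
Require Import Defs.
From mathcomp Require Import measurable_realfun lra ring.

(** If [J s t] is additive and [J s t - f s (g t - g s) = O((t - s)^q)] with
    [q > 1], then repeated bisection shows that this remainder is at most
    [C A B (t - s)^(2 beta)] as soon as [f] and [g] are [beta]-Hoelder with
    constants [A] and [B] and [beta > 1/2] (Young, Loeve). The same bisection
    applied to the difference of two such [J] gives the existence of the
    generalized integral and its independence of the approximation; for
    Lipschitz [F] and [G] the a priori bound holds for [int F G'] because [G]
    is the integral of its almost everywhere derivative.

    Hence [Y s t := sum_j int x_j dy_j - y_j dx_j] differs from
    [sum_j x_j(s) y_j(t) - x_j(t) y_j(s)] by [O([pi gamma]^2 (t-s)^(2 alpha))].
    If [gamma] is Hoelder for the Koranyi metric, the additive quantity
    [gamma^t(t) - gamma^t(s) + 2 Y s t] is [O((t - s)^(2 alpha))], so it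
    vanishes; conversely, if it vanishes, the vertical part of
    [d_K(gamma(b), gamma(a))] is controlled by the remainder of [Y]. *)

Set Implicit Arguments.
Unset Strict Implicit.
Unset Printing Implicit Defensive.

Local Open Scope classical_set_scope.
Local Open Scope ring_scope.

(** * Lipschitz functions and the fundamental theorem of calculus *)


Section density.
Context {R : realType}.
Notation mu := (@lebesgue_measure R).

Lemma lebesgue_stieltjes_itv (f : cumulative R R) (s t : R) : s <= t ->
  lebesgue_stieltjes_measure f `]s, t] = (f t - f s)%:E.
Proof.
move=> st; rewrite /lebesgue_stieltjes_measure /measure_extension.
rewrite measurable_mu_extE/=; last exact: is_ocitv.
by rewrite wlength_itv_bnd.
Qed.

Lemma lipschitz_continuous (k : R) (g : R -> R) :
  (forall x y, `|g x - g y| <= k * `|x - y|) -> continuous g.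
Proof.
move=> gk x.
have k0 : 0 <= k.
  have := gk 1 0; rewrite subr0 normr1 mulr1; exact: le_trans.
apply/cvgrPdist_le => e e0.
near=> y; apply: le_trans (gk _ _) _.
rewrite (@le_trans _ _ ((k + 1) * `|x - y|))// ?ler_wpM2r ?lerDl//.
rewrite -ler_pdivlMl ?ltr_wpDl//.
near: y; apply: cvgr_dist_le => //.
by rewrite mulr_gt0// invr_gt0 ltr_wpDl.
Unshelve. all: by end_near. Qed.

(** Both [g] and [x - g x] are nondecreasing and continuous, so each has a Stieltjes measure, and
    the two measures add up to Lebesgue measure. The first is therefore dominated by Lebesgue
    measure, and its Radon-Nikodym derivative is the density. *)
Lemma lipschitz_stieltjes_density (g : R -> R) (a b : R) :
  (forall x y, x <= y -> 0 <= g y - g x <= y - x) ->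
  exists h : R -> R, mu.-integrable setT (EFin \o h) /\
    forall s t, a <= s -> s <= t -> t <= b ->
      \int[mu]_(x in `[s, t]) h x = g t - g s.
Proof.
move=> gP.
have g_nd : nondecreasing g by move=> x y /gP; lra.
have g'_nd : nondecreasing (fun x => x - g x) by move=> x y /gP; lra.
have g_rc : right_continuous g.
  apply/right_continuousW/(@lipschitz_continuous 1) => x y; rewrite mul1r.
  wlog xy : x y / x <= y => [wl|].
    by have [/wl//|/ltW/wl] := leP x y; rewrite distrC (distrC y).
  by move: (gP _ _ xy) => ?; rewrite ler_norml distrC ger0_norm; lra.
have g'_rc : right_continuous (fun x => x - g x).
  apply/right_continuousW/(@lipschitz_continuous 1) => x y; rewrite mul1r.
  wlog xy : x y / x <= y => [wl|].
    by have [/wl//|/ltW/wl] := leP x y; rewrite distrC (distrC y).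
  by move: (gP _ _ xy) => ?; rewrite ler_norml distrC ger0_norm; lra.
pose gc : cumulative R R := HB.pack g (isCumulative.Build R _ R g g_nd g_rc).
pose gc' : cumulative R R := HB.pack (fun x => x - g x)
  (isCumulative.Build R _ R (fun x => x - g x) g'_nd g'_rc).
pose nu : {measure set (measurableTypeR R) -> \bar R} :=
  lebesgue_stieltjes_measure gc.
pose nu' : {measure set (measurableTypeR R) -> \bar R} :=
  lebesgue_stieltjes_measure gc'.
have nuE s t : s <= t -> nu `]s, t]%classic = (g t - g s)%:E.
  exact: (lebesgue_stieltjes_itv gc).
have nu'E s t : s <= t -> nu' `]s, t]%classic = (t - g t - (s - g s))%:E.
  exact: (lebesgue_stieltjes_itv gc').
(* By uniqueness of Lebesgue measure it suffices to compare lengths of half-open intervals. *)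
have muE A : measurable A -> mu A = (nu A + nu' A)%E.
  move=> mA; rewrite -(measure_addE nu nu' A).
  apply: lebesgue_measure_unique => // X oX.
  transitivity (nu X + nu' X)%E; last exact/esym/measure_addE.
  case: oX => -[s t] _ <- /=.
  have [st|ts] := leP s t; last first.
    rewrite set_itv_ge ?bnd_simp -?leNgt ?ltW//.
    by rewrite !measure0 adde0.
  rewrite [LHS]lebesgue_stieltjes_itv// nuE// nu'E//.
  by rewrite -EFinD /=; congr EFin; lra.
have nuab : (nu `]a, b]%classic < +oo)%E.
  have [ab|ba] := leP a b; first by rewrite nuE// ltry.
  by rewrite set_itv_ge ?measure0// -leNgt bnd_simp ltW.
have mab : measurable (`]a, b]%classic : set (measurableTypeR R)).
  exact: measurable_itv.
(* Restriction to []a, b]] makes the measure finite, hence the density integrable on the whole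
   line. *)
pose nuf : {finite_measure set (measurableTypeR R) -> \bar R} :=
  mfrestr mab nuab.
have dom : nuf `<< mu.
  apply/null_content_dominatesP => A mA muA.
  have := muE _ mA; rewrite muA => /esym/eqP.
  rewrite padde_eq0// => /andP[/eqP nuA _].
  rewrite /nuf/= /mfrestr /mrestr.
  by apply: (subset_measure0 (B := A)) => //; exact: measurableI.
have [f [ffin intf fE]] : exists f : R -> \bar R,
    [/\ forall x, f x \is a fin_num, mu.-integrable setT f &
        forall A : set R, measurable A -> nuf A = (\int[mu]_(x in A) f x)%E].
  by have [f [? ? ? ?]] := radon_nikodym_sigma_finite dom; exists f; split.
exists (fine \o f).
have -> : EFin \o (fine \o f) = f by apply/funext => x /=; rewrite fineK.
split=> // s t as_ st tb.
rewrite /Rintegral; under eq_integral do rewrite /= fineK//.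
rewrite -integral_itv_obnd_cbnd; last first.
  by case/integrableP : intf => mf _; exact: measurable_funS mf.
rewrite -fE//= /mfrestr /mrestr setIidl.
  by rewrite nuE.
by apply: subset_itv; rewrite bnd_simp.
Qed.

End density.


Section clamp.
Context {R : realType}.
Implicit Types a b x y : R.

(** Precomposition with this projection extends a function from [a, b] to the line and keeps its
    Lipschitz or Hoelder constant. *)
Definition clamp a b x : R := Num.max a (Num.min b x).

Lemma clamp_in a b x : a <= b -> a <= clamp a b x <= b.
Proof.
move=> ab; rewrite /clamp.
by case: (leP b x) => ?; [case: (leP a b)|case: (leP a x)]; lra.
Qed.

Lemma clamp_id a b x : a <= x <= b -> clamp a b x = x.
Proof.
rewrite /clamp.
by case: (leP b x) => ?; [case: (leP a b)|case: (leP a x)]; lra.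
Qed.

Lemma clamp_lip a b x y : a <= b -> `|clamp a b x - clamp a b y| <= `|x - y|.
Proof.
move=> ab; wlog xy : x y / x <= y => [wl|].
  by have [/wl//|/ltW/wl] := leP x y; rewrite distrC (distrC y).
rewrite ler_norml (distrC x) ger0_norm; last lra.
by rewrite /clamp; case: (leP b x) => ?; case: (leP b y) => ?;
  case: (leP a b) => ? //; try (case: (leP a x) => ?);
  try (case: (leP a y) => ?); lra.
Qed.

End clamp.

Section ftc.
Context {R : realType}.
Notation mu := (@lebesgue_measure R).

Lemma integrable_mulrl (A : set R) (c : R) (h : R -> R) : measurable A ->
  mu.-integrable A (EFin \o h) -> mu.-integrable A (fun x : R => (c * h x)%:E).
Proof.
by move=> mA ih; under eq_fun do rewrite EFinM; exact: integrableZl ih.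
Qed.

Lemma derive1_norm_le (k a b x : R) (G : R -> R) : a < x < b ->
  (forall x y, a <= x <= b -> a <= y <= b -> `|G x - G y| <= k * `|x - y|) ->
  derivable G x 1 -> `|derive1 G x| <= k.
Proof.
move=> axb Gk dG; rewrite derive1E /derive.
have H : \forall h \near 0^', `|h^-1 *: (G (h *: 1 + x) - G x)| <= k.
  near=> h.
  have h0 : h != 0 by near: h; exact: nbhs_dnbhs_neq.
  rewrite normrZ normfV ler_pdivrMl ?normr_gt0// mulrC.
  have hd : `|h| <= Num.min (x - a) (b - x).
    near: h; apply: dnbhs0_le; rewrite lt_min; lra.
  have := Gk (h *: 1 + x) x; rewrite addrK.
  have -> : h *: (1 : R) = h by rewrite /GRing.scale/= mulr1.
  move: hd; rewrite le_min !ler_norml => hd; apply; lra.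
rewrite ler_norml; apply/andP; split.
  apply: limr_ge; first exact: dG.
  by apply: filterS H => h; rewrite ler_norml => /andP[].
apply: limr_le; first exact: dG.
by apply: filterS H => h; rewrite ler_norml => /andP[].
Unshelve. all: by end_near. Qed.

(* Up to an affine change, [G] is the distribution function of a measure
   dominated by Lebesgue measure; its Radon-Nikodym density is [G'] almost
   everywhere by the Lebesgue differentiation theorem. *)
Lemma lipschitz_ftc (k a b : R) (G : R -> R) : a <= b -> 0 < k ->
  (forall x y, a <= x <= b -> a <= y <= b -> `|G x - G y| <= k * `|x - y|) ->
  exists (h : R -> R) (N : set R),
  [/\ mu.-integrable `[a, b] (EFin \o h), measurable N, mu N = 0,
    (forall x, a <= x <= b -> ~ N x -> derive1 G x = h x /\ `|h x| <= k) &
    forall s t, a <= s -> s <= t -> t <= b ->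
      \int[mu]_(x in `[s, t]) h x = G t - G s].
Proof.
move=> ab k0 Gk.
(* Adding [k * x] to a [k]-Lipschitz function makes it nondecreasing and [2 * k]-Lipschitz; dividing
   by [2 * k] brings the increments between 0 and [y - x]. *)
pose g x := (G (clamp a b x) + k * x) / (2 * k).
have gP x y : x <= y -> 0 <= g y - g x <= y - x.
  move=> xy.
  have := Gk (clamp a b y) (clamp a b x) (clamp_in _ ab) (clamp_in _ ab).
  move/le_trans/(_ (ler_wpM2l (ltW k0) (clamp_lip _ _ ab))).
  rewrite [X in _ <= _ * X]ger0_norm; last lra.
  rewrite ler_norml /g -mulrBl => H.
  by rewrite ler_pdivrMr ?divr_ge0//; lra.
have [h0 [ih0 h0E]] := lipschitz_stieltjes_density a b gP.
have gG x : a <= x <= b -> g x = (G x + k * x) / (2 * k).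
  by move=> xab; rewrite /g clamp_id.
have ihS (A : set R) : measurable A -> mu.-integrable A (EFin \o h0).
  by move=> mA; apply: integrableS ih0.
have [N [mN muN NP]] := FTC1 (fun y => ihS `[a, y]%classic (measurable_itv _))
  (open_integrable_locally openT ih0).
(* This undoes the affine change at the level of densities. *)
pose h x := 2 * k * h0 x - k.
have ih2 (A : set R) : measurable A ->
    mu.-integrable A (fun x : R => (2 * k * h0 x)%:E).
  by move=> mA; apply: integrable_mulrl => //; exact: ihS.
have ih (A : set R) : measurable A -> (mu A < +oo)%E ->
    mu.-integrable A (EFin \o h).
  move=> mA muA.
  apply: (@integrableB _ _ _ mu A mA (fun x => (2 * k * h0 x)%:E) (fun=> k%:E)).
    exact: ih2.
  apply: (@measurable_bounded_integrable _ _ _ mu (fun=> k) A) => //.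
  exact: bounded_cst.
(* The endpoints join the null set: there [derive1 G] sees values of [G] outside [a, b], about which
   nothing is known. *)
exists h, (N `|` [set a] `|` [set b]); split.
- apply: ih => //=; rewrite lebesgue_measure_itv /=; case: ifP => // _.
  by rewrite -EFinD ltry.
- by apply: measurableU => //; exact: measurableU.
- by rewrite measureU0 ?measureU0//;
    [exact: lebesgue_measure_set1|exact: measurableU
    |exact: lebesgue_measure_set1].
- move=> x xab /not_orP[/not_orP[Nx /= xa] /= xb].
  have {}xab : a < x < b.
    case/andP : xab => ax bx; rewrite !lt_neqAle ax bx !andbT.
    by apply/andP; split; apply/eqP => E; [exact: xa|exact: xb].
  have [] : derivable (fun y => \int[mu]_(t in `[a, y]) h0 t) x 1 /\
      derive1 (fun y => \int[mu]_(t in `[a, y]) h0 t) x = h0 x.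
    apply: contrapT => H; apply: Nx; apply: NP => /= H'; apply: H; apply: H'.
    by rewrite lte_fin; case/andP : xab.
  set F := (fun y => _) => dF F'.
  have FG : \forall y \near x, (2 * k) * F y - k * y + (G a + k * a) = G y.
    near=> y.
    have yab : a <= y <= b.
      apply/andP; split; apply: ltW; near: y.
        by apply: lt_nbhsr; lra.
      by apply: lt_nbhsl; lra.
    rewrite /F h0E//; try lra.
    by rewrite !gG//; [field; lra|lra].
  have d0 : is_derive x 1
      (fun y => (2 * k) * F y - k * y + (G a + k * a)) (h x).
    have dF' : is_derive x (1 : R) F (h0 x).
      by apply: DeriveDef => //; rewrite -derive1E.
    have -> : h x = (2 * k) *: h0 x - k *: 1 + 0.
      by rewrite addr0 /h /GRing.scale/= mulr1.
    by apply: is_deriveD.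
  have [dG G'] := near_eq_is_derive FG d0.
  split; first by rewrite derive1E.
  by rewrite -G' -derive1E; apply: derive1_norm_le xab _ dG.
- move=> s t as_ st tb.
  have fst : (mu `[s, t] < +oo)%E.
    by rewrite lebesgue_measure_itv /=; case: ifP => // _; rewrite -EFinD ltry.
  have muE : fine (mu `[s, t]) = t - s.
    rewrite lebesgue_measure_itv /= lte_fin; case: ltP => //= ts.
    by apply/esym/eqP; rewrite subr_eq0 eq_le ts.
  rewrite /h (@RintegralB _ _ _ mu `[s, t]%classic (fun x => 2 * k * h0 x)
    (fun=> k))//=; last 2 first.
    exact: ih2.
  by apply: measurable_bounded_integrable => //; exact: bounded_cst.
  rewrite RintegralZl//; last exact: ihS.
  rewrite h0E// Rintegral_cst// [fine _]muE.
  by rewrite !gG; [field; lra|lra|lra].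
Unshelve. all: by end_near. Qed.

End ftc.


(** * Integrals of possibly non-measurable functions that agree off a null set *)

Section null.
Context d (T : measurableType d) (R : realType).
Variable mu : {measure set T -> \bar R}.
Import HBNNSimple.

(** This is the supremum to which [integral] unfolds on the positive and negative parts; it makes
    sense without measurability of [f]. *)
Let nnint (f : T -> \bar R) : \bar R :=
  ereal_sup [set sintegral mu h | h in [set h : {nnsfun T >-> R} |
    forall x, ((h x)%:E <= f x)%E]].

Let nnint_le_off_null (N : set T) (f g : T -> \bar R) : measurable N ->
  mu N = 0 -> (forall x, (0 <= g x)%E) ->
  (forall x, ~ N x -> (f x <= g x)%E) -> (nnint f <= nnint g)%E.
Proof.
move=> mN muN g0 fg; apply: ge_ereal_sup => _ [h /= hf <-].
(* Cutting the simple function to 0 on [N] keeps its integral and puts it below [g] everywhere,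
   since [g] is nonnegative. *)
pose h' := proj_nnsfun h (measurableC mN).
have -> : sintegral mu h = sintegral mu h'.
  rewrite -!integralT_nnsfun; apply: ae_eq_integral => //.
  - exact/measurable_EFinP.
  - exact/measurable_EFinP.
  exists N; split => // x /= hx; apply: contrapT => Nx; apply: hx => _.
  by rewrite /h' /= mindicE mem_set// mulr1.
apply: ereal_sup_ubound; exists h' => //= x.
have [Nx|Nx] := pselect (N x).
  by rewrite /h' /= mindicE memNset ?mulr0//=.
rewrite /h' /= mindicE mem_set// mulr1.
exact: le_trans (hf x) (fg _ Nx).
Qed.

(* [f] may be non-measurable, as [derive1 G] a priori is: changing a simple
   function on a null set does not change its integral. *)
Lemma eq_integral_off_null (D N : set T) (f g : T -> \bar R) :
  measurable N -> mu N = 0 -> (forall x, D x -> ~ N x -> f x = g x) ->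
  (\int[mu]_(x in D) f x = \int[mu]_(x in D) g x)%E.
Proof.
move=> mN muN fg.
have E x : ~ N x -> (f \_ D) x = (g \_ D) x.
  by move=> Nx; rewrite !patchE; case: ifPn => //; rewrite inE => /fg; exact.
have eqn (u v : T -> \bar R) : (forall x, (0 <= u x)%E) ->
    (forall x, (0 <= v x)%E) -> (forall x, ~ N x -> u x = v x) ->
    nnint u = nnint v.
  move=> u0 v0 uv; apply/eqP; rewrite eq_le; apply/andP; split.
    by apply: (nnint_le_off_null mN) => // x /uv ->.
  by apply: (nnint_le_off_null mN) => // x /uv ->.
rewrite /integral; congr (_ - _)%E; apply: eqn => x;
  rewrite ?funepos_ge0// ?funeneg_ge0//.
  by move=> Nx; rewrite !funeposE E.
by move=> Nx; rewrite !funenegE E.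
Qed.

End null.


(** * The integral of F dG for Lipschitz functions *)

Section stieltjes.
Context {R : realType}.
Notation mu := (@lebesgue_measure R).

Lemma lebesgue_measure_itvcc (s t : R) : s <= t -> mu `[s, t] = (t - s)%:E.
Proof.
move=> st; rewrite lebesgue_measure_itv /= lte_fin; case: ltP => [//|ts].
by congr EFin; apply/esym/eqP; rewrite subr_eq0 eq_le ts.
Qed.

Lemma lipschitz_measurable_bounded (k a b : R) (F : R -> R) : a <= b ->
  (forall x y, a <= x <= b -> a <= y <= b -> `|F x - F y| <= k * `|x - y|) ->
  measurable_fun `[a, b] F /\ [bounded F x | x in `[a, b]].
Proof.
move=> ab Fk; split.
  apply: (@eq_measurable_fun _ _ _ _ _ (F \o clamp a b)).
    by move=> x; rewrite inE/= in_itv/= => xab; rewrite clamp_id.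
  apply: (@measurable_funS _ _ _ _ setT) => //.
  apply: continuous_measurable_fun.
  apply: (@lipschitz_continuous _ `|k|) => x y.
  apply: le_trans (Fk _ _ (clamp_in _ ab) (clamp_in _ ab)) _.
  rewrite (le_trans (ler_wpM2r _ (ler_norm k)))// ler_wpM2l//.
  exact: clamp_lip.
exists (`|F a| + `|k| * (b - a)); split; first by rewrite num_real.
move=> M kM x /=; rewrite in_itv/= => xab; apply: le_trans (ltW kM).
rewrite -[F x](subrK (F a)) addrC (le_trans (ler_normD _ _))// lerD2l.
have aab : a <= a <= b by lra.
apply: le_trans (Fk _ _ xab aab) _.
rewrite (le_trans (ler_wpM2r _ (ler_norm k)))// ler_wpM2l//.
rewrite ger0_norm; lra.
Qed.

(** With [h] a density of [G], the remainder is the integral of (F x - F s) h x over [s, t]. The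
    first factor is O(t - s) and [h] is bounded, whence the square. [K] depends on the Lipschitz
    constants, so this is only an a priori bound for sewing. *)
Lemma lipschitz_stieltjes_integral (k l a b : R) (F G : R -> R) : a <= b ->
  (forall x y, a <= x <= b -> a <= y <= b -> `|F x - F y| <= k * `|x - y|) ->
  (forall x y, a <= x <= b -> a <= y <= b -> `|G x - G y| <= l * `|x - y|) ->
  let I s t := \int[mu]_(x in `[s, t]) (F x * derive1 G x) in
  (forall s m t, a <= s -> s <= m -> m <= t -> t <= b ->
    I s t = I s m + I m t) /\
  exists K, forall s t, a <= s -> s <= t -> t <= b ->
    `|I s t - F s * (G t - G s)| <= K * (t - s) ^+ 2.
Proof.
move=> ab Fk Gl I.
(* [l] may be 0 or negative, whereas [lipschitz_ftc] asks for a positive constant. *)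
have Gl' x y : a <= x <= b -> a <= y <= b ->
    `|G x - G y| <= (`|l| + 1) * `|x - y|.
  move=> xab yab; apply: le_trans (Gl _ _ xab yab) _.
  by rewrite ler_wpM2r// (le_trans (ler_norm l))// lerDl.
have l0 : 0 < `|l| + 1 by rewrite ltr_wpDl.
have [h [N [ih mN muN hN hE]]] := lipschitz_ftc ab l0 Gl'.
have [mF bF] := lipschitz_measurable_bounded ab Fk.
have sub s t : a <= s -> t <= b -> `[s, t]%classic `<=` `[a, b]%classic.
  by move=> as_ tb; apply: subset_itv; rewrite bnd_simp.
have iFh : mu.-integrable `[a, b] (EFin \o (F \* h)).
  rewrite (_ : _ \o _ = (EFin \o F) \* (EFin \o h))%E.
    exact: integrableMr.
  by apply/funext => x /=; rewrite EFinM.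
have iFhS s t : a <= s -> t <= b -> mu.-integrable `[s, t] (EFin \o (F \* h)).
  by move=> as_ tb; apply: integrableS iFh => //; exact: sub.
have IE s t : a <= s -> t <= b -> I s t = \int[mu]_(x in `[s, t]) (F x * h x).
  move=> as_ tb; rewrite /I /Rintegral; congr fine.
  apply: (@eq_integral_off_null _ _ _ mu _ N) => // x /(sub _ _ as_ tb).
  by rewrite /= in_itv/= => xab /(hN _ xab)[->].
split.
  move=> s m t as_ sm mt tb.
  rewrite !IE//; try lra.
  apply/eqP; rewrite addrC -subr_eq; apply/eqP.
  rewrite Rintegral_itvB//; [|exact: iFhS|by rewrite bnd_simp..].
  rewrite -Rintegral_itv_obnd_cbnd//.
  apply: integrableS (iFhS m t _ _) => //; last lra.
  by apply: subset_itvr; rewrite bnd_simp.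
exists (`|k| * (`|l| + 1)) => s t as_ st tb.
have ihst : mu.-integrable `[s, t] (EFin \o h).
  by apply: integrableS ih => //; exact: sub.
have iFs : mu.-integrable `[s, t] (fun x : R => (F s * h x)%:E).
  exact: integrable_mulrl.
pose u x := F x * h x - F s * h x.
have iu : mu.-integrable `[s, t] (EFin \o u).
  apply: (@integrableB _ _ _ mu `[s,t]%classic _ (EFin \o (F \* h))
    (fun x => (F s * h x)%:E)) => //; first exact: iFhS.
rewrite IE// -hE// -RintegralZl//.
rewrite -(@RintegralB _ _ _ mu `[s, t]%classic (F \* h) (fun x => F s * h x))//;
  last exact: iFhS.
rewrite -lee_fin EFin_normr_Rintegral//.
apply: le_trans (le_abse_integral _ _ _) _ => //.
  by case/integrableP : iu.
apply: (@le_trans _ _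
  (\int[mu]_(x in `[s, t]) (`|k| * (`|l| + 1) * (t - s))%:E)%E).
  apply: ae_ge0_le_integral => //.
  - by apply: measurableT_comp => //; case/integrableP : iu.
  - by move=> x _; rewrite lee_fin; rewrite !mulr_ge0//; lra.
  exists N; split => // x /= /not_implyP[xst]; apply: contra_notP => Nx.
  have xab := sub _ _ as_ tb _ xst.
  move: xab xst; rewrite /= !in_itv/= => xab xst.
  have [_ hx] := hN _ xab Nx.
  rewrite lee_fin -mulrBl normrM mulrAC ler_pM//.
  have sab : a <= s <= b by lra.
  apply: le_trans (Fk _ _ xab sab) _.
  rewrite (le_trans (ler_wpM2r _ (ler_norm k)))// ler_wpM2l//.
  rewrite ger0_norm; lra.
rewrite integral_cst// [X in (_ * X)%E]lebesgue_measure_itvcc//.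
by rewrite -EFinM lee_fin expr2 mulrA.
Qed.

End stieltjes.

(** * Sewing and Young estimates *)


Section sewing.
Context {R : realType}.
Implicit Types (a b s t m th K A B : R).

Lemma half_powR_lt th : 1 < th -> 2 * (2^-1 : R) `^ th < 1.
Proof.
move=> th1; rewrite -ltr_pdivlMl// mulr1.
rewrite -[ltRHS]powRr1// -ltr_ln ?posrE ?powR_gt0//.
rewrite !ln_powR ltr_nM2r//.
by rewrite ln_lt0//; lra.
Qed.

(** The sum of the geometric series of ratio 2^(1 - th): the N-th bisection produces 2^N defects,
    each at most K (2^-N (t - s))^th. *)
Definition sewing_const th : R := (1 - 2 * 2^-1 `^ th)^-1.

Lemma sewing_const_ge0 th : 1 < th -> 0 <= sewing_const th.
Proof. by move=> /half_powR_lt H; rewrite invr_ge0; lra. Qed.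

(* Iterating the midpoint splitting [N] times multiplies the a priori bound by
   [(2 * 2^-th0) ^ N], which tends to [0]. *)
Lemma sewing a b th th0 K K0 (E : R -> R -> R) :
  1 < th -> 1 < th0 -> 0 <= K ->
  (forall s t, a <= s -> s <= t -> t <= b -> `|E s t| <= K0 * (t - s) `^ th0) ->
  (forall s t, a <= s -> s <= t -> t <= b ->
    `|E s t - E s ((s + t) / 2) - E ((s + t) / 2) t| <= K * (t - s) `^ th) ->
  forall s t, a <= s -> s <= t -> t <= b ->
    `|E s t| <= sewing_const th * K * (t - s) `^ th.
Proof.
move=> th1 th01 K0_ E0 EK.
pose r : R := 2 * 2^-1 `^ th; pose r0 : R := 2 * 2^-1 `^ th0.
have r1 : r < 1 := half_powR_lt th1.
have r01 : r0 < 1 := half_powR_lt th01.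
have half s t p : s <= t -> ((t - s) / 2) `^ p = 2^-1 `^ p * (t - s) `^ p.
  by move=> st; rewrite mulrC powRM//; lra.
have main N : forall s t, a <= s -> s <= t -> t <= b -> `|E s t| <=
    sewing_const th * K * (t - s) `^ th + K0 * (t - s) `^ th0 * r0 ^+ N.
  elim: N => [s t as_ st tb|N IH s t as_ st tb].
    rewrite expr0 mulr1; apply: le_trans (E0 _ _ as_ st tb) _.
    by rewrite lerDr !mulr_ge0 ?powR_ge0 ?sewing_const_ge0.
  set m := (s + t) / 2.
  have -> : E s t = E s t - E s m - E m t + E s m + E m t by ring.
  have sm : s <= m by rewrite /m; lra.
  have mt : m <= t by rewrite /m; lra.
  apply: le_trans (ler_normD _ _) _.
  apply: le_trans (lerD (ler_normD _ _) (lexx _)) _.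
  have H1 := EK _ _ as_ st tb.
  have H2 := IH s m as_ sm (le_trans mt tb).
  have H3 := IH m t (le_trans as_ sm) mt tb.
  move: H1 H2 H3; rewrite -/m.
  have -> : m - s = (t - s) / 2 by rewrite /m; field.
  have -> : t - m = (t - s) / 2 by rewrite /m; field.
  rewrite !half// => H1 H2 H3.
  apply: le_trans (lerD (lerD H1 H2) H3) _.
  set x := (t - s) `^ th; set y := (t - s) `^ th0.
  (* Equality holds, because S = 1 / (1 - r) satisfies S = 1 + r S. *)
  rewrite le_eqVlt; apply/orP; left; apply/eqP.
  have -> : sewing_const th = (1 - r)^-1 by [].
  have -> : 2^-1 `^ th = r / 2 by rewrite /r; field.
  have -> : 2^-1 `^ th0 = r0 / 2 by rewrite /r0; field.
  by rewrite exprS; field; lra.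
move=> s t as_ st tb.
have r00 : 0 <= r0 by rewrite /r0 mulr_ge0// powR_ge0.
have : (sewing_const th * K * (t - s) `^ th + K0 * (t - s) `^ th0 * r0 ^+ N)
    @[N --> \oo] --> sewing_const th * K * (t - s) `^ th.
  rewrite -[X in _ --> X]addr0; apply: cvgD; first exact: cvg_cst.
  rewrite -(mulr0 (K0 * (t - s) `^ th0)); apply: cvgM; first exact: cvg_cst.
  by apply: cvg_expr; rewrite ger0_norm.
move/cvgr_to_ge; apply; near=> N; exact: main.
Unshelve. all: by end_near. Qed.

End sewing.


(** * Young estimates for additive functions of intervals *)

Section young.
Context {R : realType}.
Implicit Types (a b s t m p q K A B M e : R) (f g F G : R -> R)
  (I J : R -> R -> R).

Definition hoelder_bound a b p A f := forall x y,
  a <= x <= b -> a <= y <= b -> `|f x - f y| <= A * `|x - y| `^ p.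

Definition additive_on a b I := forall s m t,
  a <= s -> s <= m -> m <= t -> t <= b -> I s t = I s m + I m t.

Lemma powR_mono p (x y : R) : 0 <= p -> 0 <= x -> x <= y -> x `^ p <= y `^ p.
Proof.
by move=> p0 x0 xy; apply: ge0_ler_powR => //; rewrite nnegrE// (le_trans x0).
Qed.

Lemma powR_le1 p (x : R) : 0 <= p -> 0 <= x -> x <= 1 -> x `^ p <= 1.
Proof. by move=> p0 x0 x1; have := powR_mono p0 x0 x1; rewrite powR1. Qed.

Lemma powR_antimono (x p q : R) : 0 < p -> 0 <= x -> x <= 1 -> p <= q ->
  x `^ q <= x `^ p.
Proof.
move=> p0; rewrite le_eqVlt => /predU1P[<- _ pq|x0 x1 pq].
  by rewrite !powR0 ?gt_eqF// (lt_le_trans p0).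
by apply: ger_powR => //; rewrite x0.
Qed.

Lemma powR_square p (x : R) : 0 < p -> x `^ p * x `^ p = x `^ (2 * p).
Proof.
move=> p0; rewrite mulr_natl mulr2n powRD//.
by rewrite gt_eqF// addr_gt0.
Qed.

Lemma hoelder_bound_le a b p A f s t x y : 0 <= p -> 0 <= A ->
  hoelder_bound a b p A f -> a <= s -> t <= b ->
  s <= x <= t -> s <= y <= t -> `|f x - f y| <= A * (t - s) `^ p.
Proof.
move=> p0 A0 fA as_ tb xst yst.
have xab : a <= x <= b by lra.
have yab : a <= y <= b by lra.
apply: le_trans (fA _ _ xab yab) _; apply: ler_wpM2l => //.
by apply: powR_mono => //; rewrite ler_norml; lra.
Qed.

Lemma hoelder_boundS a b a' b' p A f : a <= a' -> b' <= b ->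
  hoelder_bound a b p A f -> hoelder_bound a' b' p A f.
Proof. by move=> aa bb fA x y xab yab; apply: fA; lra. Qed.

Lemma hoelder_boundW a b p q A f : 0 < q -> q <= p -> b - a <= 1 -> 0 <= A ->
  hoelder_bound a b p A f -> hoelder_bound a b q A f.
Proof.
move=> q0 qp ba A0 fA x y xab yab.
apply: le_trans (fA _ _ xab yab) _; apply: ler_wpM2l => //.
by apply: powR_antimono => //; rewrite ler_norml; lra.
Qed.

(** As [I] is additive, the midpoint defect of the remainder is (f m - f s)(g t - g m), hence at
    most A B (t - s)^(2p). The a priori [K] and [q] only start the bisection and leave no trace in
    the conclusion. *)
Lemma young_estimate a b p q A B K f g I : 1 < 2 * p -> 1 < q ->
  0 <= A -> 0 <= B -> hoelder_bound a b p A f -> hoelder_bound a b p B g ->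
  additive_on a b I ->
  (forall s t, a <= s -> s <= t -> t <= b ->
    `|I s t - f s * (g t - g s)| <= K * (t - s) `^ q) ->
  forall s t, a <= s -> s <= t -> t <= b ->
    `|I s t - f s * (g t - g s)| <=
      sewing_const (2 * p) * (A * B) * (t - s) `^ (2 * p).
Proof.
move=> p1 q1 A0 B0 fA gB Iadd IK.
have p0 : 0 < p by lra.
apply: sewing p1 q1 (mulr_ge0 A0 B0) IK _ => s t as_ st tb.
set m := (s + t) / 2.
have sm : s <= m by rewrite /m; lra.
have mt : m <= t by rewrite /m; lra.
rewrite (Iadd s m t)// (_ : _ - _ = (f m - f s) * (g t - g m)); last by ring.
rewrite normrM -powR_square// mulrACA; apply: ler_pM => //.
  by apply: hoelder_bound_le fA _ _ _ _ => //; lra.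
by apply: hoelder_bound_le gB _ _ _ _ => //; lra.
Qed.

(** Sewing is applied to the difference of the two remainders. Its midpoint defect is a sum of two
    products, each with one increment of [f - F] or [g - G], so the bound is linear in [e]. Since
    [b - a <= 1], powers of [t - s] are bounded by 1. *)
Lemma young_difference a b p q A B M K K' e f g F G I J :
  1 < 2 * p -> 1 < q -> b - a <= 1 ->
  0 <= A -> 0 <= B -> 0 <= e -> 0 <= M ->
  hoelder_bound a b p A F -> hoelder_bound a b p B g ->
  hoelder_bound a b p e (f \- F) -> hoelder_bound a b p e (g \- G) ->
  (forall x, a <= x <= b -> `|f x - F x| <= e) ->
  (forall x, a <= x <= b -> `|F x| <= M) ->
  additive_on a b I -> additive_on a b J ->
  (forall s t, a <= s -> s <= t -> t <= b ->
    `|I s t - f s * (g t - g s)| <= K * (t - s) `^ q) ->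
  (forall s t, a <= s -> s <= t -> t <= b ->
    `|J s t - F s * (G t - G s)| <= K' * (t - s) `^ q) ->
  forall s t, a <= s -> s <= t -> t <= b ->
    `|I s t - J s t| <= e * (B + M + sewing_const (2 * p) * (A + B)).
Proof.
move=> p1 q1 ba A0 B0 e0 M0 FA gB fFe gGe fF FM Iadd Jadd IK JK s t as_ st tb.
have p0 : 0 < p by lra.
pose E s t := (I s t - f s * (g t - g s)) - (J s t - F s * (G t - G s)).
have EK s' t' : a <= s' -> s' <= t' -> t' <= b ->
    `|E s' t'| <= (K + K') * (t' - s') `^ q.
  move=> as' st' tb'; apply: le_trans (ler_normB _ _) _.
  by rewrite mulrDl lerD ?IK ?JK.
have eAB : 0 <= e * (A + B) by rewrite mulr_ge0 ?addr_ge0.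
have H : `|E s t| <= sewing_const (2 * p) * (e * (A + B)) * (t - s) `^ (2 * p).
  apply: (sewing p1 q1 eAB EK _ as_ st tb) => s' t' as' st' tb'.
  set m := (s' + t') / 2.
  have sm : s' <= m by rewrite /m; lra.
  have mt : m <= t' by rewrite /m; lra.
  rewrite /E (Iadd s' m t')// (Jadd s' m t')//.
  rewrite (_ : _ - _ = ((f \- F) m - (f \- F) s') * (g t' - g m) +
    (F m - F s') * ((g \- G) t' - (g \- G) m)); last by rewrite /=; ring.
  apply: le_trans (ler_normD _ _) _.
  rewrite !normrM -powR_square// (mulrC e) mulrDl mulrDl addrC.
  rewrite (mulrC B e) [A * e * _]mulrACA [e * B * _]mulrACA.
  apply: lerD; apply: ler_pM => //.
  - by apply: hoelder_bound_le FA _ _ _ _ => //; lra.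
  - by apply: hoelder_bound_le gGe _ _ _ _ => //; lra.
  - by apply: hoelder_bound_le fFe _ _ _ _ => //; lra.
  - by apply: hoelder_bound_le gB _ _ _ _ => //; lra.
have ts1 : 0 <= t - s <= 1 by lra.
(* The difference of the two germs is split so that every product has one factor of size [e]. *)
have -> : I s t - J s t = (f s - F s) * (g t - g s)
    + F s * ((g \- G) t - (g \- G) s) + E s t by rewrite /E /=; ring.
apply: le_trans (ler_normD _ _) _.
rewrite [leRHS]mulrDr; apply: lerD; last first.
  apply: le_trans H _; rewrite -[leRHS]mulr1 (mulrCA e).
  apply: ler_wpM2l; first by rewrite mulr_ge0// sewing_const_ge0.
  by apply: powR_le1; lra.
apply: le_trans (ler_normD _ _) _.
rewrite !normrM [leRHS]mulrDr (mulrC e M).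
have sab : a <= s <= b by lra.
have le1 (c x : R) : 0 <= c -> x <= c * (t - s) `^ p -> x <= c.
  move=> c0 /le_trans; apply; rewrite -[leRHS]mulr1.
  by apply: ler_wpM2l => //; apply: powR_le1; lra.
apply: lerD; apply: ler_pM => //; rewrite ?fF ?FM//; apply: le1 => //.
  by apply: hoelder_bound_le gB _ _ _ _ => //; lra.
by apply: hoelder_bound_le gGe _ _ _ _ => //; lra.
Qed.

End young.

(** * Lipschitz approximation by inf-convolution *)


Section infconv.
Context {R : realType}.
Variables (A p e : R) (f : R -> R).
Hypotheses (A0 : 0 <= A) (p0 : 0 < p) (p1 : p <= 1) (e0 : 0 < e).
Hypothesis fA : forall x y, `|f x - f y| <= A * `|x - y| `^ p.

(** With this slope, [k * |z|] meets A |z|^p at |z| = e; beyond distance [e] the penalty outweighs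
    the Hoelder variation of [f]. *)
Let k := A * e `^ p / e.

(** The largest [k]-Lipschitz function below [f]. Taking the infimum over displacements [z] makes
    the operation commute with translations, so the Hoelder constant of [f] is inherited. *)
Definition infconv x : R := inf [set f (x + z) + k * `|z| | z in [set: R]].

Let k0 : 0 <= k. Proof. by rewrite /k divr_ge0 ?mulr_ge0 ?powR_ge0// ltW. Qed.

Let slope (z : R) : A * `|z| `^ p <= A * e `^ p + k * `|z|.
Proof.
have [ze|ez] := leP `|z| e.
  rewrite -[leLHS]addr0; apply: lerD; last by rewrite mulr_ge0.
  by rewrite ler_wpM2l// powR_mono// ltW.
rewrite -[leLHS]add0r lerD ?mulr_ge0 ?powR_ge0//.
have -> : k * `|z| = A * (e `^ p * (`|z| / e)).
  by rewrite /k; field; rewrite gt_eqF.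
apply: ler_wpM2l => //.
have {1}-> : `|z| = e * (`|z| / e) by field; rewrite gt_eqF.
rewrite powRM ?divr_ge0 ?(ltW e0)// ler_wpM2l ?powR_ge0// ler1_powR//.
by rewrite ler_pdivlMr// mul1r ltW.
Qed.

Let lbnd x z : f x - A * e `^ p <= f (x + z) + k * `|z|.
Proof.
have := fA x (x + z); rewrite opprD addNKr normrN => /le_trans/(_ (slope z)).
by rewrite ler_norml; lra.
Qed.

Let infconv_le x z : infconv x <= f (x + z) + k * `|z|.
Proof.
apply: ge_inf; last by exists z.
by exists (f x - A * e `^ p) => _ [y _ <-]; exact: lbnd.
Qed.

Let infconv_ge x (c : R) :
  (forall z, c <= f (x + z) + k * `|z|) -> c <= infconv x.
Proof.
move=> cP; apply: lb_le_inf; first by exists (f (x + 0) + k * `|0 : R|), 0.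
by move=> _ [z _ <-]; exact: cP.
Qed.

Lemma infconv_dist x : `|infconv x - f x| <= A * e `^ p.
Proof.
have := infconv_le x 0; rewrite addr0 normr0 mulr0 addr0 => H1.
have H2 := infconv_ge (lbnd x).
have H3 : 0 <= A * e `^ p by rewrite mulr_ge0 ?powR_ge0.
by rewrite ler_norml; lra.
Qed.

Lemma infconv_hoelder x y : `|infconv x - infconv y| <= A * `|x - y| `^ p.
Proof.
have H u v : infconv u - A * `|u - v| `^ p <= infconv v.
  apply: infconv_ge => z.
  have := infconv_le u z; have := fA (u + z) (v + z).
  have -> : u + z - (v + z) = u - v by ring.
  by rewrite ler_norml; lra.
by rewrite ler_norml; have := H x y; have := H y x; rewrite (distrC y); lra.
Qed.

Lemma infconv_lipschitz x y : `|infconv x - infconv y| <= k * `|x - y|.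
Proof.
have H u v : infconv u - k * `|u - v| <= infconv v.
  apply: infconv_ge => z.
  have := infconv_le u (v - u + z).
  have -> : u + (v - u + z) = v + z by ring.
  have : k * `|v - u + z| <= k * (`|u - v| + `|z|).
    by rewrite ler_wpM2l// (distrC u) ler_normD.
  by rewrite mulrDr; lra.
by rewrite ler_norml; have := H x y; have := H y x; rewrite (distrC y); lra.
Qed.

(** At distances up to [e] the Hoelder bounds of both functions are used, beyond [e] their uniform
    distance A e^p. Either way the lower exponent gains e^(p - q), which tends to 0 only if q <
    p. *)
Lemma infconv_hoelder_dist q x y : 0 < q -> q <= p ->
  `|infconv x - f x - (infconv y - f y)| <=
    2 * A * e `^ (p - q) * `|x - y| `^ q.
Proof.
move=> q0 qp.
have powE (u : R) : u `^ p = u `^ (p - q) * u `^ q.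
  by rewrite -powRD subrK// gt_eqF.
have [xye|exy] := leP `|x - y| e.
  have -> : infconv x - f x - (infconv y - f y) =
    (infconv x - infconv y) - (f x - f y) by ring.
  apply: le_trans (ler_normB _ _) _.
  apply: le_trans (lerD (infconv_hoelder _ _) (fA _ _)) _.
  have H : `|x - y| `^ p <= e `^ (p - q) * `|x - y| `^ q.
    by rewrite powE ler_wpM2r ?powR_ge0// powR_mono// subr_ge0.
  by have := ler_wpM2l A0 H; lra.
apply: le_trans (ler_normB _ _) _.
apply: le_trans (lerD (infconv_dist _) (infconv_dist _)) _.
have H : e `^ p <= e `^ (p - q) * `|x - y| `^ q.
  by rewrite powE ler_wpM2l ?powR_ge0// powR_mono// ltW.
by have := ler_wpM2l A0 H; lra.
Qed.

End infconv.

(** * The generalized integral *)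


Section close.
Context {R : realType}.
Implicit Types (a b s t m p q K A B M e : R) (f g h F G : R -> R)
  (I J : R -> R -> R).

(** A real-valued form of smallness of [hoelder_norm], equivalent to it up to a factor 2 when a <
    b. *)
Definition close_on a b p e f F :=
  (forall x, a <= x <= b -> `|F x - f x| <= e) /\
  hoelder_bound a b p e (F \- f).

Lemma close_on_sym a b p e f F : close_on a b p e f F -> close_on a b p e F f.
Proof.
case=> H1 H2; split=> [x xab|x y xab yab /=]; first by rewrite distrC H1.
have := H2 _ _ xab yab; rewrite -normrN /=.
by congr (`| _ | <= _); ring.
Qed.

Lemma close_on_trans a b p e e' f g h : close_on a b p e f g ->
  close_on a b p e' g h -> close_on a b p (e + e') f h.
Proof.
move=> [H1 H2] [H1' H2']; split=> [x xab|x y xab yab /=].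
  have -> : h x - f x = (g x - f x) + (h x - g x) by ring.
  by rewrite (le_trans (ler_normD _ _))// lerD ?H1 ?H1'.
have -> : h x - f x - (h y - f y) =
  (g x - f x - (g y - f y)) + (h x - g x - (h y - g y)) by ring.
rewrite (le_trans (ler_normD _ _))// mulrDl.
by apply: lerD; [exact: H2|exact: H2'].
Qed.

Lemma close_on_hoelder a b p e A f F : close_on a b p e f F ->
  hoelder_bound a b p A f -> hoelder_bound a b p (A + e) F.
Proof.
move=> [_ H] fA x y xab yab.
have -> : F x - F y = (f x - f y) + (F x - f x - (F y - f y)) by ring.
rewrite (le_trans (ler_normD _ _))// mulrDl.
by apply: lerD; [exact: fA|exact: H].
Qed.

Lemma close_on_bounded a b p e M f F : close_on a b p e f F ->
  (forall x, a <= x <= b -> `|f x| <= M) ->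
  forall x, a <= x <= b -> `|F x| <= M + e.
Proof.
move=> [H _] fM x xab; rewrite -[F x](subrK (f x)) addrC.
by rewrite (le_trans (ler_normD _ _))// lerD ?fM ?H.
Qed.

Lemma hoelder_bounded a b p A f : 0 <= p -> 0 <= A -> a <= b -> b - a <= 1 ->
  hoelder_bound a b p A f -> forall x, a <= x <= b -> `|f x| <= `|f a| + A.
Proof.
move=> p0 A0 ab ba fA x xab; rewrite -[f x](subrK (f a)) addrC.
rewrite (le_trans (ler_normD _ _))// lerD2l.
have aab : a <= a <= b by lra.
apply: le_trans (fA _ _ xab aab) _; rewrite -[leRHS]mulr1 ler_wpM2l//.
by rewrite powR_le1// ler_norml; lra.
Qed.

Lemma young_close a b p A B M e K K' f g F G I J :
  1 < 2 * p -> b - a <= 1 -> 0 <= A -> 0 <= B -> 0 <= M -> 0 <= e ->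
  close_on a b p e f F -> close_on a b p e g G ->
  hoelder_bound a b p A F -> hoelder_bound a b p B g ->
  (forall x, a <= x <= b -> `|F x| <= M) ->
  additive_on a b I -> additive_on a b J ->
  (forall s t, a <= s -> s <= t -> t <= b ->
    `|I s t - f s * (g t - g s)| <= K * (t - s) `^ (2 * p)) ->
  (forall s t, a <= s -> s <= t -> t <= b ->
    `|J s t - F s * (G t - G s)| <= K' * (t - s) `^ (2 * p)) ->
  forall s t, a <= s -> s <= t -> t <= b ->
    `|I s t - J s t| <= e * (B + M + sewing_const (2 * p) * (A + B)).
Proof.
move=> p1 ba A0 B0 M0 e0 fF gG FA gB FM Iadd Jadd IK JK.
have [fF1 fF2] := close_on_sym fF; have [_ gG2] := close_on_sym gG.
exact: (@young_difference _ a b p _ A B M K K' e f g F G I J p1 p1).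
Qed.

Lemma lipschitz_setP a b K f : K.-lipschitz_(`[a, b]) f <->
  (forall x y, a <= x <= b -> a <= y <= b -> `|f x - f y| <= K * `|x - y|).
Proof.
split=> [H x y xab yab|H [x y] /= []]; last first.
  by rewrite !in_itv/= => xab yab; exact: H.
by apply: (H (x, y)); split; rewrite /= in_itv.
Qed.

Lemma hoelder_norm_le_bounds a b p e h : a < b -> 0 <= e ->
  (hoelder_norm a b p h <= e%:E)%E ->
  (forall x, a <= x <= b -> `|h x| <= e) /\ hoelder_bound a b p e h.
Proof.
move=> ab e0; rewrite /hoelder_norm; set S1 := ereal_sup _.
set S2 := hoelder_seminorm _ _ _ _ _ => Se.
have aI : `[a, b]%classic a by rewrite /= in_itv/= lexx ltW.
have bI : `[a, b]%classic b by rewrite /= in_itv/= lexx ltW.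
have S10 : (0 <= S1)%E.
  apply: (@le_trans _ _ `|h a|%:E); first by rewrite lee_fin.
  by apply: ereal_sup_ubound; exists a.
(* The pair a <> b keeps this supremum from being -oo; with both terms nonnegative, each is bounded
   by the sum. *)
have S20 : (0 <= S2)%E.
  apply: (@le_trans _ _ (`|h a - h b| / `|a - b| `^ p)%:E).
    by rewrite lee_fin divr_ge0// powR_ge0.
  apply: ereal_sup_ubound; exists a, b; split=> //.
  by apply/eqP; rewrite lt_eqF.
have S1e : (S1 <= e%:E)%E by apply: le_trans Se; rewrite leeDl.
have S2e : (S2 <= e%:E)%E by apply: le_trans Se; rewrite leeDr.
split=> [x xab|x y xab yab].
  rewrite -lee_fin; apply: le_trans S1e.
  by apply: ereal_sup_ubound; exists x => //=; rewrite in_itv.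
have [->|xy] := eqVneq x y.
  by rewrite !subrr normr0 mulr_ge0// powR_ge0.
rewrite -ler_pdivrMr ?powR_gt0 ?normr_gt0 ?subr_eq0// -lee_fin.
apply: le_trans S2e; apply: ereal_sup_ubound; exists x, y.
by split; rewrite /= ?in_itv//; apply/eqP.
Qed.

Lemma hoelder_norm_ge0_le a b p e e' h : a < b ->
  (forall x, a <= x <= b -> `|h x| <= e) -> hoelder_bound a b p e' h ->
  (0 <= hoelder_norm a b p h <= (e + e')%:E)%E.
Proof.
move=> ab he he'; rewrite /hoelder_norm EFinD.
have aI : `[a, b]%classic a by rewrite /= in_itv/= lexx ltW.
have bI : `[a, b]%classic b by rewrite /= in_itv/= lexx ltW.
apply/andP; split; [apply: adde_ge0|apply: leeD].
- apply: (@le_trans _ _ `|h a|%:E); first by rewrite lee_fin.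
  by apply: ereal_sup_ubound; exists a.
- apply: (@le_trans _ _ (`|h a - h b| / `|a - b| `^ p)%:E).
    by rewrite lee_fin divr_ge0// powR_ge0.
  apply: ereal_sup_ubound; exists a, b; split=> //.
  by apply/eqP; rewrite lt_eqF.
- apply: ge_ereal_sup => _ [x + <-]; rewrite /= in_itv/= => xab.
  by rewrite lee_fin he.
- apply: ge_ereal_sup => _ [x [y [+ + /eqP xy ->]]].
  rewrite /= !in_itv/= => xab yab.
  rewrite lee_fin ler_pdivrMr ?powR_gt0 ?normr_gt0 ?subr_eq0//.
  exact: he'.
Qed.

Lemma lipschitz_approx_close a b p f (F : R -> R -> R) : a < b ->
  lipschitz_approx a b p f F -> forall e, 0 < e ->
  \forall d \near 0^'+, close_on a b p e f (F d).
Proof.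
move=> ab [_ /fine_cvgP[fin /cvgrPdist_le H]] e e0.
near=> d.
have fd : hoelder_norm a b p (F d \- f) \is a fin_num by near: d.
have [] // := @hoelder_norm_le_bounds a b p e (F d \- f) ab (ltW e0).
rewrite -(fineK fd) lee_fin.
have : `|0 - fine (hoelder_norm a b p (F d \- f))| <= e by near: d; exact: H.
by rewrite sub0r normrN; apply: le_trans; exact: ler_norm.
Unshelve. all: by end_near. Qed.

End close.


(** * Integrals of Lipschitz approximations and their limit *)

Section gen_integral.
Context {R : realType}.
Notation mu := (@lebesgue_measure R).
Implicit Types (a b s t m p q K A B M e al be : R) (f g h F G : R -> R)
  (I J : R -> R -> R).

Definition stieltjes_int F G s t : R :=
  \int[mu]_(x in `[s, t]) (F x * derive1 G x).

(** The exponent 2 is weakened to 2p, possible on an interval of length at most 1, to share an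
    exponent with the Hoelder remainders in [young_close]. *)
Lemma stieltjes_int_germ a b p k l F G : a <= b -> b - a <= 1 ->
  0 < p -> p <= 1 ->
  k.-lipschitz_(`[a, b]) F -> l.-lipschitz_(`[a, b]) G ->
  additive_on a b (stieltjes_int F G) /\
  exists K, forall s t, a <= s -> s <= t -> t <= b ->
    `|stieltjes_int F G s t - F s * (G t - G s)| <= K * (t - s) `^ (2 * p).
Proof.
move=> ab ba p0 p1 /lipschitz_setP Fk /lipschitz_setP Gl.
have [Iadd [K IK]] := lipschitz_stieltjes_integral ab Fk Gl.
split=> //; exists `|K| => s t as_ st tb.
apply: le_trans (IK _ _ as_ st tb) _.
rewrite (le_trans (ler_wpM2r _ (ler_norm K)))// ?sqr_ge0// ler_wpM2l//.
rewrite -powR_mulrn; last lra.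
by apply: powR_antimono; lra.
Qed.

(** One family, built from the extension of [f] to the line, serves all subintervals at once. *)
Lemma lipschitz_approx_exists p q A f : 0 <= A -> 0 < q -> q < p -> p <= 1 ->
  hoelder_bound 0 1 p A f ->
  exists F : R -> R -> R,
    forall a b, 0 <= a -> a < b -> b <= 1 -> lipschitz_approx a b q f F.
Proof.
move=> A0 q0 qp p1 fA; have p0 : 0 < p by lra.
pose f' := f \o clamp 0 1.
have f'A x y : `|f' x - f' y| <= A * `|x - y| `^ p.
  apply: le_trans (fA _ _ (clamp_in _ ler01) (clamp_in _ ler01)) _.
  rewrite ler_wpM2l// powR_mono//; first exact: ltW.
  exact: clamp_lip.
have f'f x : 0 <= x <= 1 -> f' x = f x by move=> ?; rewrite /f' /= clamp_id.
exists (fun e => infconv A p e f') => a b a0 ab b1; split.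
  move=> e e0; exists (A * e `^ p / e); apply/lipschitz_setP => x y _ _.
  exact: infconv_lipschitz.
pose c e := A * e `^ p + 2 * A * e `^ (p - q).
apply: (@squeeze_cvge _ _ _ _ (cst 0%E) _ (fun e => (c e)%:E)).
- near=> e.
  have e0 : 0 < e by near: e; exact: nbhs_right_gt.
  apply: hoelder_norm_ge0_le => // [x xab /=|x y xab yab /=].
    by rewrite -f'f ?infconv_dist//; lra.
  by rewrite -!f'f ?infconv_hoelder_dist//; lra.
- exact: cvg_cst.
- apply/fine_cvgP; split; first by near=> e.
  have : c e @[e --> 0^'+] --> A * 0 + 2 * A * 0.
    by apply: cvgD; apply: cvgM; try exact: cvg_cst; apply: powR_cvg0; lra.
  by rewrite !mulr0 addr0.
Unshelve. all: by end_near. Qed.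

(** By [young_close], the integrals of two approximations differ by a multiple of their distance, so
    they are Cauchy; the limit inherits additivity and a remainder bound. *)
Lemma stieltjes_int_limit p A B f g (F G : R -> R -> R) :
  1 < 2 * p -> p <= 1 -> 0 <= A -> 0 <= B ->
  hoelder_bound 0 1 p A f -> hoelder_bound 0 1 p B g ->
  lipschitz_approx 0 1 p f F -> lipschitz_approx 0 1 p g G ->
  exists J, additive_on 0 1 J /\ exists K,
    forall s t, 0 <= s -> s <= t -> t <= 1 ->
      `|J s t - f s * (g t - g s)| <= K * (t - s) `^ (2 * p).
Proof.
move=> p1 ple A0 B0 fA gB Ff Gg; have p0 : 0 < p by lra.
pose M := `|f 0| + A.
have fM : forall x, 0 <= x <= 1 -> `|f x| <= M.
  by apply: hoelder_bounded fA; lra.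
have M0 : 0 <= M by rewrite addr_ge0.
have c0 : 0 <= sewing_const (2 * p) :> R by exact: sewing_const_ge0.
have Fclose := lipschitz_approx_close ltr01 Ff.
have Gclose := lipschitz_approx_close ltr01 Gg.
have germ e : 0 < e -> additive_on 0 1 (stieltjes_int (F e) (G e)) /\
  exists K, forall s t, 0 <= s -> s <= t -> t <= 1 ->
    `|stieltjes_int (F e) (G e) s t - F e s * (G e t - G e s)| <=
      K * (t - s) `^ (2 * p).
  move=> e0; have [k Fk] := Ff.1 _ e0; have [l Gl] := Gg.1 _ e0.
  by apply: stieltjes_int_germ Fk Gl => //; lra.
have cv s t : 0 <= s -> s <= t -> t <= 1 ->
    cvg (stieltjes_int (F e) (G e) s t @[e --> 0^'+]).
  move=> s0 st t1; apply: cauchy_cvg; apply: cauchy_exP => eps eps0.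
  pose c : R := (B + 1) + (M + 1) + sewing_const (2 * p) * ((A + 1) + (B + 1)).
  have cpos : 0 < c by rewrite ltr_wpDr ?mulr_ge0//; lra.
  (* Two approximations that are [eta]-close to the target are [2 * eta]-close to each other, and
     [2 * eta * c] is at most [eps / 2]. The cap 1 justifies the bounds [A + 1], [B + 1] and [M + 1]
     inside [c]. *)
  pose eta : R := Num.min 1 (eps / (4 * c)).
  have eta0 : 0 < eta by rewrite lt_min ltr01 divr_gt0// mulr_gt0.
  have eta1 : eta <= 1 by rewrite ge_min lexx.
  have etac : (eta + eta) * c < eps.
    have : eta <= eps / (4 * c) by rewrite ge_min lexx orbT.
    rewrite ler_pdivlMr ?mulr_gt0//; lra.
  have good : \forall e \near 0^'+, [/\ 0 < e, close_on 0 1 p eta f (F e) &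
      close_on 0 1 p eta g (G e)].
    by near=> e; split; near: e;
      [exact: nbhs_right_gt|exact: Fclose|exact: Gclose].
  have [e0 [e00 Fe0 Ge0]] := filter_ex good.
  exists (stieltjes_int (F e0) (G e0) s t).
  apply: (@filterS _ (0^'+ : set_system R) _ _ _ _ good) => e [epos Fe Ge].
  have [Iadd [K IK]] := germ _ e00.
  have [Jadd [K' JK]] := germ _ epos.
  apply: le_lt_trans etac.
  have hA : hoelder_bound 0 1 p (A + 1) (F e).
    move=> x y xab yab; apply: le_trans (close_on_hoelder Fe fA xab yab) _.
    by rewrite ler_wpM2r ?powR_ge0// lerD2l.
  have hB : hoelder_bound 0 1 p (B + 1) (G e0).
    move=> x y xab yab; apply: le_trans (close_on_hoelder Ge0 gB xab yab) _.
    by rewrite ler_wpM2r ?powR_ge0// lerD2l.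
  have hM x : 0 <= x <= 1 -> `|F e x| <= M + 1.
    by move=> xab; apply: le_trans (close_on_bounded Fe fM xab) _; lra.
  apply: (young_close p1 _ _ _ _ _ (close_on_trans (close_on_sym Fe0) Fe)
    (close_on_trans (close_on_sym Ge0) Ge) hA hB hM Iadd Jadd IK JK); lra.
exists (fun s t => lim (stieltjes_int (F e) (G e) s t @[e --> 0^'+])).
split.
  move=> s m t s0 sm mt t1.
  apply: cvg_lim; first exact: Rhausdorff.
  have : (stieltjes_int (F e) (G e) s m + stieltjes_int (F e) (G e) m t)
      @[e --> 0^'+] --> lim (stieltjes_int (F e) (G e) s m @[e --> 0^'+]) +
        lim (stieltjes_int (F e) (G e) m t @[e --> 0^'+]).
    by apply: cvgD; apply: cv; lra.
  apply: cvg_trans; apply: near_eq_cvg; near=> e.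
  have e0 : 0 < e by near: e; exact: nbhs_right_gt.
  by rewrite ((germ _ e0).1 s m t).
exists (sewing_const (2 * p) * ((A + 1) * (B + 1))) => s t s0 st t1.
have Fcv x : 0 <= x <= 1 -> F e x @[e --> 0^'+] --> f x.
  move=> x01; apply/cvgrPdist_le => eps eps0; near=> e.
  have [H _] : close_on 0 1 p eps f (F e) by near: e; exact: Fclose.
  by rewrite distrC; exact: H.
have Gcv x : 0 <= x <= 1 -> G e x @[e --> 0^'+] --> g x.
  move=> x01; apply/cvgrPdist_le => eps eps0; near=> e.
  have [H _] : close_on 0 1 p eps g (G e) by near: e; exact: Gclose.
  by rewrite distrC; exact: H.
have : `|stieltjes_int (F e) (G e) s t - F e s * (G e t - G e s)|
    @[e --> 0^'+] --> `|lim (stieltjes_int (F e) (G e) s t @[e --> 0^'+])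
      - f s * (g t - g s)|.
  apply: cvg_norm; apply: cvgB; first exact: cv.
  by apply: cvgM; [apply: Fcv; lra|apply: cvgB; apply: Gcv; lra].
move/cvgr_to_le; apply; near=> e.
have e0 : 0 < e by near: e; exact: nbhs_right_gt.
have Fe : close_on 0 1 p 1 f (F e) by near: e; exact: Fclose.
have Ge : close_on 0 1 p 1 g (G e) by near: e; exact: Gclose.
have [Iadd [K IK]] := germ _ e0.
(* The [K] at hand depends on [e]; the Young estimate replaces it by a constant independent of [e],
   which survives the limit. *)
apply: (young_estimate p1 p1 _ _ (close_on_hoelder Fe fA)
  (close_on_hoelder Ge gB) Iadd IK) => //; lra.
Unshelve. all: by end_near. Qed.

End gen_integral.


(** * Existence of the generalized integral and independence of the approximation *)

Section gen_integral.
Context {R : realType}.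
Implicit Types (a b s t m p q K A B M e al be : R) (f g h : R -> R)
  (F G J : R -> R -> R).

(** An additive [J] with the right germ is compared directly with the integrals of the
    approximations, so every admissible approximation has the limit [J a b]. *)
Lemma stieltjes_int_cvg al be A B K a b f g J F G :
  1 < 2 * be -> be <= al -> al <= 1 -> 0 <= A -> 0 <= B ->
  a < b -> b - a <= 1 ->
  hoelder_bound a b al A f -> hoelder_bound a b al B g ->
  additive_on a b J ->
  (forall s t, a <= s -> s <= t -> t <= b ->
    `|J s t - f s * (g t - g s)| <= K * (t - s) `^ (2 * al)) ->
  lipschitz_approx a b be f F -> lipschitz_approx a b be g G ->
  stieltjes_int (F e) (G e) a b @[e --> 0^'+] --> J a b.
Proof.
move=> be1 beal al1 A0 B0 ab ba fA gB Jadd JK Ff Gg.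
have be0 : 0 < be by lra.
have {}fA : hoelder_bound a b be A f by apply: hoelder_boundW fA.
have {}gB : hoelder_bound a b be B g by apply: hoelder_boundW gB.
have {}JK s t : a <= s -> s <= t -> t <= b ->
    `|J s t - f s * (g t - g s)| <= `|K| * (t - s) `^ (2 * be).
  move=> as_ st tb; apply: le_trans (JK _ _ as_ st tb) _.
  rewrite (le_trans (ler_wpM2r _ (ler_norm K)))// ?powR_ge0// ler_wpM2l//.
  by apply: powR_antimono; lra.
pose M := `|f a| + A.
have fM : forall x, a <= x <= b -> `|f x| <= M.
  by apply: hoelder_bounded fA; lra.
have M0 : 0 <= M by rewrite addr_ge0.
have c0 : 0 <= sewing_const (2 * be) :> R by exact: sewing_const_ge0.
pose c : R := B + (M + 1) + sewing_const (2 * be) * ((A + 1) + B).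
have cpos : 0 < c by rewrite ltr_wpDr ?mulr_ge0//; lra.
apply/cvgrPdist_le => eps eps0.
pose eta : R := Num.min 1 (eps / c).
have eta0 : 0 < eta by rewrite lt_min ltr01 divr_gt0.
have eta1 : eta <= 1 by rewrite ge_min lexx.
have etac : eta * c <= eps by rewrite -ler_pdivlMr// ge_min lexx orbT.
near=> e.
have e0 : 0 < e by near: e; exact: nbhs_right_gt.
have Fe : close_on a b be eta f (F e).
  by near: e; exact: lipschitz_approx_close.
have Ge : close_on a b be eta g (G e).
  by near: e; exact: lipschitz_approx_close.
have [k Fk] := Ff.1 _ e0; have [l Gl] := Gg.1 _ e0.
have [|||Iadd [K' IK]] := stieltjes_int_germ _ _ be0 _ Fk Gl; try lra.
apply: le_trans etac.
have hA : hoelder_bound a b be (A + 1) (F e).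
  move=> x y xab yab; apply: le_trans (close_on_hoelder Fe fA xab yab) _.
  by rewrite ler_wpM2r ?powR_ge0// lerD2l.
have hM x : a <= x <= b -> `|F e x| <= M + 1.
  by move=> xab; apply: le_trans (close_on_bounded Fe fM xab) _; lra.
apply: (young_close be1 _ _ _ _ _ Fe Ge hA gB hM Jadd Iadd JK IK); lra.
Unshelve. all: by end_near. Qed.

Lemma young_integral al A B f g : 2^-1 < al -> al <= 1 -> 0 <= A -> 0 <= B ->
  hoelder_bound 0 1 al A f -> hoelder_bound 0 1 al B g ->
  exists J, [/\ additive_on 0 1 J,
    forall s t, 0 <= s -> s <= t -> t <= 1 ->
      `|J s t - f s * (g t - g s)| <=
        sewing_const (2 * al) * (A * B) * (t - s) `^ (2 * al) &
    forall a b, 0 <= a -> a < b -> b <= 1 -> gen_integral al a b f g = J a b].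
Proof.
move=> al2 al1 A0 B0 fA gB.
(* The inf-convolutions converge only for exponents strictly below [al], and sewing needs one above
   1/2. *)
pose be := (2^-1 + al) / 2.
have be2 : 1 < 2 * be by rewrite /be; lra.
have beal : be < al by rewrite /be; lra.
have be0 : 0 < be by lra.
have [F Ff] := lipschitz_approx_exists A0 be0 beal al1 fA.
have [G Gg] := lipschitz_approx_exists B0 be0 beal al1 gB.
have fbe : hoelder_bound 0 1 be A f by apply: hoelder_boundW fA => //; lra.
have gbe : hoelder_bound 0 1 be B g by apply: hoelder_boundW gB => //; lra.
have [|J [Jadd [K JK]]] := stieltjes_int_limit be2 _ A0 B0 fbe gbe
  (Ff _ _ (lexx _) ltr01 (lexx _)) (Gg _ _ (lexx _) ltr01 (lexx _)).
  by lra.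
have al21 : 1 < 2 * al by lra.
(* The exponent rises from 2 be to 2 al, with a constant explicit in [A] and [B]. *)
have JE := young_estimate al21 be2 A0 B0 fA gB Jadd JK.
exists J; split=> // a b a0 ab b1.
have cv be' (F' G' : R -> R -> R) : 2^-1 < be' <= al ->
    lipschitz_approx a b be' f F' -> lipschitz_approx a b be' g G' ->
    stieltjes_int (F' e) (G' e) a b @[e --> 0^'+] --> J a b.
  move=> be'P Ff' Gg'.
  apply: (stieltjes_int_cvg _ _ al1 A0 B0 ab _ _ _ _ _ Ff' Gg'); try lra.
  - exact: hoelder_boundS fA.
  - exact: hoelder_boundS gB.
  - by move=> s m t ? ? ? ?; apply: Jadd; lra.
  - by move=> s t ? ? ?; apply: JE; lra.
have ex : is_gen_integral al a b f g (J a b).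
  exists be, F, G; split; [lra|exact: Ff|exact: Gg|].
  by apply: (cv be); [lra|exact: Ff|exact: Gg].
(* The value selected by [get] comes with some approximation, whose limit is also [J a b]. *)
have [be' [F' [G' [be'P Ff' Gg' H]]]] :
    is_gen_integral al a b f g (gen_integral al a b f g).
  by apply: getPex; exists (J a b).
exact: (cvg_unique (@Rhausdorff R) H (cv _ _ _ be'P Ff' Gg')).
Qed.

End gen_integral.

(** * Curves in the Heisenberg group *)


Section heisenberg.
Context {R : realType} {n : nat}.
Implicit Types (p q : 'rV[R]_(n.*2.+1)) (al A L a b r d s t : R).

Lemma dist_eucl_ge0 k (u v : 'rV[R]_k) : 0 <= dist_eucl u v.
Proof. exact: sqrtr_ge0. Qed.

Lemma dist_euclxx k (u : 'rV[R]_k) : dist_eucl u u = 0.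
Proof.
rewrite /dist_eucl big1 ?sqrtr0// => i _.
by rewrite subrr expr0n.
Qed.

Lemma dist_eucl_coord k (u v : 'rV[R]_k) i :
  `|u ord0 i - v ord0 i| <= dist_eucl u v.
Proof.
rewrite -sqrtr_sqr ler_sqrt; last by apply: sumr_ge0 => j _; rewrite sqr_ge0.
by rewrite (bigD1 i)//= lerDl sumr_ge0// => j _; rewrite sqr_ge0.
Qed.

Lemma hproj_coord (i : nat) : (i < n.*2)%N ->
  exists k : 'I_(n.*2), forall p, p ord0 (inord i) = hproj p ord0 k.
Proof.
move=> ni; exists (Ordinal ni) => p; rewrite mxE; congr (p _ _).
apply: val_inj; rewrite /= inordK; last by rewrite ltnS ltnW.
by rewrite /bump leqNgt ni.
Qed.

Lemma xcoord_le (j : 'I_n) p q :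
  `|xcoord j p - xcoord j q| <= dist_eucl (hproj p) (hproj q).
Proof.
have [|k kE] := @hproj_coord j.*2; first by rewrite ltn_double.
by rewrite /xcoord !kE dist_eucl_coord.
Qed.

Lemma ycoord_le (j : 'I_n) p q :
  `|ycoord j p - ycoord j q| <= dist_eucl (hproj p) (hproj q).
Proof.
have [|k kE] := @hproj_coord j.*2.+1; first by rewrite ltn_Sdouble.
by rewrite /ycoord !kE dist_eucl_coord.
Qed.

(** At [gamma t], [gamma s] this is the germ at s of the sum of x dy - y dx. Correspondingly,
    [tpart p q] is the vertical coordinate of q^-1 p in the Heisenberg group. *)
Definition area p q : R :=
  \sum_(j < n) (xcoord j q * ycoord j p - xcoord j p * ycoord j q).

Definition tpart p q : R := tcoord p - tcoord q + 2 * area p q.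

Lemma areaC p q : area p q = - area q p.
Proof. by rewrite /area -sumrN; apply: eq_bigr => j _; ring. Qed.

Lemma koranyi_pow4 p q :
  dist_koranyi p q ^+ 4 = dist_eucl (hproj p) (hproj q) ^+ 4 + tpart p q ^+ 2.
Proof.
rewrite /dist_koranyi -powR_mulrn ?powR_ge0// -powRrM mulVf// powRr1.
  by rewrite real_normK// num_real.
by rewrite addr_ge0 ?sqr_ge0// exprn_even_ge0.
Qed.

Lemma koranyi_ge0 p q : 0 <= dist_koranyi p q.
Proof. exact: powR_ge0. Qed.

Lemma koranyi_sym p q : dist_koranyi p q = dist_koranyi q p.
Proof.
have euclC : dist_eucl (hproj p) (hproj q) = dist_eucl (hproj q) (hproj p).
  by congr Num.sqrt; apply: eq_bigr => i _; rewrite -sqrrN opprB.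
apply/eqP; rewrite -(@eqrXn2 _ 4)// ?koranyi_ge0// !koranyi_pow4 euclC.
rewrite /tpart areaC; apply/eqP; congr (_ + _); ring.
Qed.

Lemma eucl_le_koranyi p q : dist_eucl (hproj p) (hproj q) <= dist_koranyi p q.
Proof.
rewrite -(@ler_pXn2r _ 4)// ?nnegrE ?koranyi_ge0 ?dist_eucl_ge0//.
by rewrite koranyi_pow4 lerDl sqr_ge0.
Qed.

Lemma tpart_le_koranyi p q : `|tpart p q| <= dist_koranyi p q ^+ 2.
Proof.
rewrite -(@ler_pXn2r _ 2)// ?nnegrE ?sqr_ge0// -exprM koranyi_pow4.
by rewrite real_normK ?num_real// lerDr exprn_even_ge0.
Qed.

(** Heisenberg scaling: a horizontal part of size r and a vertical part of size d r^2 give a fourth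
    power of the distance at most (1 + d^2) r^4. *)
Lemma koranyi_le p q r d : 0 <= r ->
  dist_eucl (hproj p) (hproj q) <= r -> `|tpart p q| <= d * r ^+ 2 ->
  dist_koranyi p q <= (1 + d ^+ 2) `^ 4^-1 * r.
Proof.
move=> r0 er tr.
have d0 : 0 <= 1 + d ^+ 2 by rewrite addr_ge0// sqr_ge0.
rewrite -(@ler_pXn2r _ 4)// ?nnegrE ?koranyi_ge0 ?mulr_ge0 ?powR_ge0//.
have c4 : ((1 + d ^+ 2) `^ 4^-1) ^+ 4 = 1 + d ^+ 2.
  by rewrite -powR_mulrn ?powR_ge0// -powRrM mulVf// powRr1.
rewrite koranyi_pow4 exprMn c4.
rewrite mulrDl mul1r; apply: lerD.
  by rewrite ler_pXn2r ?nnegrE ?dist_eucl_ge0.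
rewrite -(@real_normK _ (tpart p q)) ?num_real//.
have -> : d ^+ 2 * r ^+ 4 = (d * r ^+ 2) ^+ 2 by ring.
by rewrite ler_pXn2r ?nnegrE// (le_trans _ tr).
Qed.

Variables (al A : R) (gamma : R -> 'rV[R]_(n.*2.+1)).
Hypotheses (al2 : 2^-1 < al) (al1 : al <= 1) (A0 : 0 <= A).
Hypothesis gammaA : forall s t, 0 <= s <= 1 -> 0 <= t <= 1 ->
  dist_eucl (hproj (gamma s)) (hproj (gamma t)) <= A * `|s - t| `^ al.

(** Each of the [n] indices contributes two Young remainders, for x dy and for y dx. *)
Let c : R := 2 * n%:R * sewing_const (2 * al).

Lemma area_integral : exists Y : R -> R -> R, [/\ additive_on 0 1 Y,
  forall s t, 0 <= s -> s <= t -> t <= 1 ->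
    `|Y s t - area (gamma t) (gamma s)| <= c * A ^+ 2 * (t - s) `^ (2 * al) &
  forall a b, 0 <= a -> a < b -> b <= 1 ->
    \sum_(j < n) (gen_integral al a b (xcoord j \o gamma) (ycoord j \o gamma)
      - gen_integral al a b (ycoord j \o gamma) (xcoord j \o gamma)) = Y a b].
Proof.
have hx j : hoelder_bound 0 1 al A (xcoord j \o gamma).
  by move=> s t s01 t01; apply: le_trans (xcoord_le _ _ _) (gammaA s01 t01).
have hy j : hoelder_bound 0 1 al A (ycoord j \o gamma).
  by move=> s t s01 t01; apply: le_trans (ycoord_le _ _ _) (gammaA s01 t01).
have /choice[J JP] : forall j : 'I_n, exists J, _ :=
  fun j => young_integral al2 al1 A0 A0 (hx j) (hy j).
have /choice[J' JP'] : forall j : 'I_n, exists J, _ :=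
  fun j => young_integral al2 al1 A0 A0 (hy j) (hx j).
exists (fun s t => \sum_(j < n) (J j s t - J' j s t)); split.
- move=> s m t s0 sm mt t1; rewrite -big_split/=; apply: eq_bigr => j _.
  have [Jadd _ _] := JP j; have [Jadd' _ _] := JP' j.
  by rewrite (Jadd s m t)// (Jadd' s m t)//; ring.
- move=> s t s0 st t1; rewrite /area -sumrB.
  apply: le_trans (ler_norm_sum _ _ _) _.
  pose B := 2 * (sewing_const (2 * al) * (A * A) * (t - s) `^ (2 * al)).
  apply: (@le_trans _ _ (\sum_(j < n) B)).
    apply: ler_sum => j _.
    have [_ JE _] := JP j; have [_ JE' _] := JP' j.
    have := JE _ _ s0 st t1; have := JE' _ _ s0 st t1 => /= H' H.
    (* The products x(s) y(s) cancel, so the area summand is the difference of the two germs. *)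
    rewrite (_ : _ - _ =
      (J j s t - xcoord j (gamma s) *
        (ycoord j (gamma t) - ycoord j (gamma s))) -
      (J' j s t - ycoord j (gamma s) *
        (xcoord j (gamma t) - xcoord j (gamma s)))); last by ring.
    by apply: le_trans (ler_normB _ _) _; rewrite /B; lra.
  rewrite sumr_const card_ord -[_ *+ n]mulr_natl.
  rewrite le_eqVlt; apply/orP; left; apply/eqP.
  by rewrite /B /c; ring.
- move=> a b a0 ab b1; apply: eq_bigr => j _.
  have [_ _ ->] // := JP j; have [_ _ ->] // := JP' j.
Qed.

Let t_formula := forall a b : R, 0 <= a -> a < b -> b <= 1 ->
  tcoord (gamma b) - tcoord (gamma a) =
  - 2 * \sum_(j < n)
    (gen_integral al a b (xcoord j \o gamma) (ycoord j \o gamma)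
     - gen_integral al a b (ycoord j \o gamma) (xcoord j \o gamma)).

Lemma koranyi_hoelder_t_formula L :
  (forall s t, 0 <= s <= 1 -> 0 <= t <= 1 ->
    dist_koranyi (gamma s) (gamma t) <= L * `|s - t| `^ al) -> t_formula.
Proof.
move=> gammaL a b a0 ab b1.
have [Y [Yadd YE YI]] := area_integral.
pose D s t := tcoord (gamma t) - tcoord (gamma s) + 2 * Y s t.
have al21 : 1 < 2 * al by move: al2; lra.
have al0 : 0 < al by lra.
have DL s t : 0 <= s -> s <= t -> t <= 1 ->
    `|D s t| <= (L ^+ 2 + 2 * (c * A ^+ 2)) * (t - s) `^ (2 * al).
  move=> s0 st t1.
  have -> : D s t = tpart (gamma t) (gamma s) +
    2 * (Y s t - area (gamma t) (gamma s)) by rewrite /D /tpart; ring.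
  apply: le_trans (ler_normD _ _) _; rewrite [leRHS]mulrDl; apply: lerD.
    apply: le_trans (tpart_le_koranyi _ _) _.
    have H : dist_koranyi (gamma t) (gamma s) <= L * (t - s) `^ al.
      by rewrite -[t - s]ger0_norm; [apply: gammaL; lra|lra].
    rewrite -powR_square// -expr2 -exprMn ler_pXn2r// ?nnegrE ?koranyi_ge0//.
    by rewrite (le_trans _ H)// koranyi_ge0.
  rewrite normrM ger0_norm// -mulrA ler_wpM2l//; exact: YE.
(* Additivity makes the midpoint defect of [D] zero, so sewing with [K = 0] gives [D = 0]. *)
have /(_ a b a0 (ltW ab) b1) : forall s t, 0 <= s -> s <= t -> t <= 1 ->
    `|D s t| <= sewing_const (2 * al) * 0 * (t - s) `^ (2 * al).
  apply: (sewing al21 al21 (lexx 0) DL) => s t s0 st t1.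
  rewrite /D (Yadd s ((s + t) / 2) t); try lra.
  by rewrite mul0r normr_le0; apply/eqP; ring.
rewrite mulr0 mul0r normr_le0 YI// => /eqP; rewrite /D; lra.
Qed.

Lemma t_formula_koranyi a b : t_formula -> 0 <= a -> a <= b -> b <= 1 ->
  dist_koranyi (gamma b) (gamma a) <=
    (1 + (2 * c) ^+ 2) `^ 4^-1 * (A * (b - a) `^ al).
Proof.
move=> tf a0 ab b1; have al0 : 0 < al by move: al2; lra.
apply: koranyi_le; first by rewrite mulr_ge0 ?powR_ge0.
  by rewrite -[b - a]ger0_norm; [apply: gammaA; lra|lra].
have [Y [Yadd YE YI]] := area_integral.
have -> : tpart (gamma b) (gamma a) = - 2 * (Y a b - area (gamma b) (gamma a)).
  (* The integral formula covers only a < b; for a = b, additivity gives [Y a a = 0]. *)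
  move: (ab); rewrite le_eqVlt => /predU1P[ba|{}ab].
    have := Yadd a a a a0 (lexx _) (lexx _); rewrite -ba in b1 * => /(_ b1) Y0.
    have -> : Y a a = 0 by lra.
    by rewrite /tpart subrr; ring.
  by rewrite /tpart tf// YI//; ring.
have -> : 2 * c * (A * (b - a) `^ al) ^+ 2 =
  2 * (c * A ^+ 2 * ((b - a) `^ al * (b - a) `^ al)) by ring.
rewrite powR_square// mulNr normrN normrM ger0_norm// ler_wpM2l//.
exact: YE.
Qed.

End heisenberg.

(** * The Hoelder seminorm on the unit interval *)

Section seminorm.
Context {R : realType} {Y : Type} (dY : Y -> Y -> R).
Hypotheses (dY0 : forall u v, 0 <= dY u v) (dYxx : forall u, dY u u = 0).

(** The seminorm is itself an admissible Hoelder constant, so the estimates above can be run with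
    [A] equal to it. The pairs s = t, absent from the supremum, are covered by [dYxx]. *)
Lemma hoelder_seminorm_fin al (f : R -> Y) :
  hoelder_on dist_real dY `[0, 1] al f -> exists A, [/\ 0 <= A,
    hoelder_seminorm dist_real dY `[0, 1] al f = A%:E &
    forall s t, 0 <= s <= 1 -> 0 <= t <= 1 ->
      dY (f s) (f t) <= A * `|s - t| `^ al].
Proof.
move=> [L fL]; set S := hoelder_seminorm _ _ _ _ _.
have I0 : `[0 : R, 1]%classic 0 by rewrite /= in_itv/= lexx ler01.
have I1 : `[0 : R, 1]%classic 1 by rewrite /= in_itv/= lexx ler01.
have S0 : (0 <= S)%E.
  apply: (@le_trans _ _ (dY (f 0) (f 1) / `|0 - 1| `^ al)%:E).
    by rewrite lee_fin divr_ge0// powR_ge0.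
  apply: ereal_sup_ubound; exists 0, 1; split=> //.
  by apply/eqP; rewrite eq_sym oner_eq0.
have SL : (S <= L%:E)%E.
  apply: ge_ereal_sup => _ [x [y [Ix Iy /eqP xy ->]]].
  rewrite lee_fin ler_pdivrMr ?powR_gt0 ?normr_gt0 ?subr_eq0//.
  exact: fL.
have Sfin : S \is a fin_num by rewrite ge0_fin_numE// (le_lt_trans SL)// ltry.
exists (fine S); rewrite fineK//; split=> //; first exact: fine_ge0.
move=> s t s01 t01; have [->|st] := eqVneq s t.
  by rewrite dYxx mulr_ge0 ?powR_ge0// fine_ge0.
rewrite -ler_pdivrMr ?powR_gt0 ?normr_gt0 ?subr_eq0// -lee_fin fineK//.
apply: ereal_sup_ubound; exists s, t.
by split; rewrite /= ?in_itv//; apply/eqP.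
Qed.

End seminorm.

Unset Implicit Arguments.

Theorem theorem7p6 (R : realType) (n : nat) (alpha : R)
    (halpha : 2^-1 < alpha <= 1) :
  exists C : R, forall gamma : R -> 'rV[R]_(n.*2.+1),
    (hoelder_on dist_real (@dist_koranyi R n) `[0, 1] alpha gamma <->
     hoelder_on dist_real (@dist_eucl R n.*2) `[0, 1] alpha
       (@hproj R n \o gamma) /\
     (forall a b : R, 0 <= a -> a < b -> b <= 1 ->
        tcoord (gamma b) - tcoord (gamma a) =
        - 2 * \sum_(j < n)
          (gen_integral alpha a b (xcoord j \o gamma) (ycoord j \o gamma)
           - gen_integral alpha a b (ycoord j \o gamma) (xcoord j \o gamma)))) /\
    (hoelder_on dist_real (@dist_koranyi R n) `[0, 1] alpha gamma ->
     forall a b : R, 0 <= a -> a < b -> b <= 1 ->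
       ((dist_koranyi (gamma b) (gamma a))%:E <=
        (C * `|b - a| `^ alpha)%R%:E *
        hoelder_seminorm dist_real (@dist_eucl R n.*2) `[0%R, 1%R] alpha
          (@hproj R n \o gamma))%E).
Proof.
case/andP: halpha => al2 al1.
(* The constant of [t_formula_koranyi], fixed before the curve is chosen. *)
pose C : R := (1 + (2 * (2 * n%:R * sewing_const (2 * alpha))) ^+ 2) `^ 4^-1.
exists C => gamma.
have proj : hoelder_on dist_real (@dist_koranyi R n) `[0, 1] alpha gamma ->
    hoelder_on dist_real (@dist_eucl R n.*2) `[0, 1] alpha
      (@hproj R n \o gamma).
  case=> L gL; exists L => x y Ix Iy.
  exact: le_trans (eucl_le_koranyi _ _) (gL _ _ Ix Iy).
have tform : hoelder_on dist_real (@dist_koranyi R n) `[0, 1] alpha gamma ->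
   forall a b : R, 0 <= a -> a < b -> b <= 1 ->
        tcoord (gamma b) - tcoord (gamma a) =
        - 2 * \sum_(j < n)
          (gen_integral alpha a b (xcoord j \o gamma) (ycoord j \o gamma)
           - gen_integral alpha a b (ycoord j \o gamma) (xcoord j \o gamma)).
  move=> gH; have [A [A0 _ gA]] := hoelder_seminorm_fin
    (@dist_eucl_ge0 _ _) (@dist_euclxx _ _) (proj gH).
  case: gH => L gL.
  apply: (koranyi_hoelder_t_formula al2 al1 A0 gA) => s t s01 t01.
  by apply: gL; rewrite /= in_itv.
split; first split.
- by move=> gH; split; [exact: proj|exact: tform].
- move=> [pH tf].
  have [A [A0 _ gA]] := hoelder_seminorm_fin
    (@dist_eucl_ge0 _ _) (@dist_euclxx _ _) pH.
  exists (C * A) => x y; rewrite /= !in_itv/= => x01 y01.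
  wlog xy : x y x01 y01 / x <= y => [wl|].
    have [/wl|/ltW/wl] := leP x y; first exact.
    by rewrite koranyi_sym /dist_real distrC; apply.
  rewrite koranyi_sym /dist_real distrC ger0_norm; last lra.
  by rewrite -mulrA; apply: t_formula_koranyi => //; lra.
- move=> gH a b a0 ab b1.
  have [A [A0 -> gA]] := hoelder_seminorm_fin
    (@dist_eucl_ge0 _ _) (@dist_euclxx _ _) (proj gH).
  rewrite -EFinM lee_fin ger0_norm; last lra.
  rewrite -mulrA (mulrC _ A); apply: t_formula_koranyi => //; last exact: ltW.
  exact: tform.
Qed.
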